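(* For every $\theta\in(0,\pi)$ and $\varepsilon>0$ there exists a set $G\subset\mathbb{R}^2$ which consists of a finite number of line segments and has the following properties. Let $\mathcal{B}=\{(\mathbf{v},\mathbf{w}):\mathbf{w}=re^{i(\theta+\pi/2)},\ \mathbf{v}=e^{i\theta},\ r\in[0,1]\}$. (i) For $\mathrm{Leb}$-almost all $r\in[0,1]$, the light ray arriving from the direction $\Gamma_{(1,0),(0,r)}$ reflects only once in a mirror in $G$ and $\mathcal{T}_G((1,0),(0,r))\in\mathcal{B}$. (ii) For all $\alpha$ satisfying $\alpha-\pi/2\in[\varepsilon,\theta-\varepsilon]\cup[\theta+\varepsilon,\pi-\varepsilon]$ we have $\mathrm{Leb}(\Pi_\alpha G)<\varepsilon$.
   Context: Identify $\mathbb{R}^2$ with $\mathbb{C}$. For an angle $\alpha$, $K_\alpha=\{re^{i\alpha}:r\in\mathbb{R}\}$, and $\Pi_\alpha A$ is the orthogonal projection of $A\subset\mathbb{R}^2$ on the line $K_\alpha$. $\mathrm{Leb}$ is one-dimensional Lebesgue measure (on $\mathbb{R}$ and on lines in $\mathbb{R}^2$). For $\mathbf{v},\mathbf{w}\in\mathbb{R}^2$ with $\mathbf{v}\perp\mathbf{w}$, $|\mathbf{v}|=1$, let $\Gamma_{\mathbf{v},\mathbf{w}}(t)=t\mathbf{v}+\mathbf{w}$, $t\in\mathbb{R}$. Light rays. Line segments in $G$ are regarded as (two-sided) mirrors. A light ray is a continuous piecewise affine map $R:\mathbb{R}\to\mathbb{R}^2$ such that $\mathbb{R}$ is partitioned into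 finitely many intervals on each of which $R(t)=(t-t_1)\mathbf{v}+\mathbf{w}$ for some $\mathbf{v}\perp\mathbf{w}$, $|\mathbf{v}|=1$, and $t_1\in\mathbb{R}$ depending on the interval; it moves at unit speed along straight lines and reflects from mirrors according to the classical law of specular reflection (angle of reflection equals angle of incidence). $R$ comes (arrives) from direction $\Gamma_{\mathbf{v}_1,\mathbf{w}_1}$ if $R(t)=(t-t_1)\mathbf{v}_1+\mathbf{w}_1$ on the interval extending to $-\infty$, and escapes in direction $\Gamma_{\mathbf{v}_2,\mathbf{w}_2}$ if $R(t)=(t-t_2)\mathbf{v}_2+\mathbf{w}_2$ on the interval extending to $+\infty$. If $G$ is a finite union of line segments and the light ray coming from direction $\Gamma_{\mathbf{v}_1,\mathbf{w}_1}$ escapes in direction $\Gamma_{\mathbf{v}_2,\mathbf{w}_2}$ after reflecting in the mirrors comprising $G$, we write $\mathcal{T}_G(\mathbf{v}_1,\mathbf{w}_1)=(\mathbf{v}_2,\mathbf{w}_2)$ (the path is not uniquely defined for rays that hit endpoints of mirrors). *)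

(* Defs.v *)
From HB Require Import structures.
From mathcomp Require Import all_boot all_order all_algebra.
From mathcomp Require Import all_classical all_reals all_analysis.

Set Implicit Arguments.
Unset Strict Implicit.
Unset Printing Implicit Defensive.

Import Order.TTheory GRing.Theory Num.Theory.
Import numFieldNormedType.Exports.

Local Open Scope classical_set_scope.
Local Open Scope ring_scope.

(* The complex number x + i y is the pair (x, y). *)
Notation plane R := (R * R)%type (only parsing).

Definition dotp (R : realType) (u v : plane R) : R := u.1 * v.1 + u.2 * v.2.

(* The library norm `|u| on a product is the sup norm. *)
Definition enorm (R : realType) (u : plane R) : R := Num.sqrt (dotp u u).

(* e^{i a} *)
Definition expi (R : realType) (a : R) : plane R := (cos a, sin a).

(* The pairs (v, w) that index the parametrized lines Gamma_{v,w}. *)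
Definition is_direction (R : realType) (v w : plane R) : Prop :=
  enorm v = 1 /\ dotp v w = 0.

Definition Gamma (R : realType) (v w : plane R) (t : R) : plane R :=
  t *: v + w.

(* A mirror is given by its two endpoints. *)
Notation mirror R := (plane R * plane R)%type (only parsing).

Definition segment (R : realType) (s : mirror R) : set (plane R) :=
  [set (1 - x) *: s.1 + x *: s.2 | x in `[0, 1]].

Definition open_segment (R : realType) (s : mirror R) : set (plane R) :=
  [set (1 - x) *: s.1 + x *: s.2 | x in `]0, 1[].

Definition mirrors_union (R : realType) (G : seq (mirror R)) : set (plane R) :=
  [set p | exists2 s, s \in G & segment s p].

(* Specular reflection of a velocity v in a line with direction vector d <> 0:
   the component of v along d is kept and the normal one changes sign. *)
Definition reflect_along (R : realType) (d v : plane R) : plane R :=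
  (2 * dotp v d / dotp d d) *: d - v.

Definition unit_speed_piecewise_affine (R : realType) (gam : R -> plane R) :
    Prop :=
  exists (n : nat) (I : 'I_n -> set R),
    [/\ partition [set: 'I_n] I [set: R],
        forall i, is_interval (I i)
      & forall i, exists (v w : plane R) (t1 : R),
          is_direction v w /\ forall t, I i t -> gam t = Gamma v w (t - t1)].

Definition velocity_before (R : realType) (gam : R -> plane R) (t : R)
    (v : plane R) : Prop :=
  \forall h \near (0 : R)^'+, gam (t - h) = gam t - h *: v.

Definition velocity_after (R : realType) (gam : R -> plane R) (t : R)
    (v : plane R) : Prop :=
  \forall h \near (0 : R)^'+, gam (t + h) = gam t + h *: v.

(* Light rays that never meet an endpoint of a mirror.  At a point common to
   two non-parallel mirrors the last condition cannot hold, so such points,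
   where reflection is ambiguous, are avoided too. *)
Definition light_ray (R : realType) (G : seq (mirror R)) (gam : R -> plane R) :
    Prop :=
  [/\ continuous gam,
      unit_speed_piecewise_affine gam,
      forall t s, s \in G -> segment s (gam t) -> open_segment s (gam t),
      forall t v v', velocity_before gam t v -> velocity_after gam t v' ->
        ~ mirrors_union G (gam t) -> v' = v
    & forall t v v', velocity_before gam t v -> velocity_after gam t v' ->
        forall s, s \in G -> segment s (gam t) ->
          v' = reflect_along (s.2 - s.1) v].

Definition comes_from (R : realType) (gam : R -> plane R) (v w : plane R) :
    Prop :=
  is_direction v w /\
  exists t1 : R, \forall t \near -oo, gam t = Gamma v w (t - t1).

Definition escapes_in (R : realType) (gam : R -> plane R) (v w : plane R) :
    Prop :=
  is_direction v w /\
  exists t2 : R, \forall t \near +oo, gam t = Gamma v w (t - t2).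

(* T_G(v1, w1) = (v2, w2): the light ray arriving from Gamma_{v1,w1} exists,
   and (it being determined up to a time shift) it escapes in Gamma_{v2,w2}. *)
Definition transfer (R : realType) (G : seq (mirror R))
    (vw1 vw2 : plane R * plane R) : Prop :=
  (exists gam, light_ray G gam /\ comes_from gam vw1.1 vw1.2) /\
  (forall gam, light_ray G gam -> comes_from gam vw1.1 vw1.2 ->
     escapes_in gam vw2.1 vw2.2).

Definition reflects_once (R : realType) (G : seq (mirror R))
    (gam : R -> plane R) : Prop :=
  exists! t : R, mirrors_union G (gam t).

Definition exit_directions (R : realType) (theta : R) :
    set (plane R * plane R) :=
  [set (expi theta, r *: expi (theta + pi / 2)) | r in `[0, 1]].

(* Orthogonal projection Pi_alpha A of A on the line K_alpha = R e^{i alpha}. *)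
Definition projection (R : realType) (alpha : R) (A : set (plane R)) :
    set (plane R) :=
  [set dotp p (expi alpha) *: expi alpha | p in A].

(* One-dimensional Lebesgue measure on K_alpha, transported by the isometry
   x |-> x e^{i alpha} from R onto K_alpha. *)
Definition line_leb (R : realType) (alpha : R) (A : set (plane R)) : \bar R :=
  lebesgue_measure [set x : R | A (x *: expi alpha)].

(* Main.v *)
(* Rays of directions 0 and theta are coordinate lines of the oblique system
   (1, 0), e^{i theta}, and a mirror of slope 1 in this system, i.e. of
   direction theta / 2, exchanges the two directions. Cutting the unit
   square into N x N cells and placing a mirror on the diagonal of the cells
   selected by a permutation therefore sends each ray of one beam, after a
   single reflection, to a ray of the other: no two mirrors share a row or a
   column. The shadow of the mirrors seen along phi is controlled by that of
   the cells, a set of numbers A y - B x with A, B bounded and bounded away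
   from 0. Substituting a permutation in the cells of another one makes the
   shadow as small as that of either, so it is enough to find finitely many
   permutations such that for every (A, B) one of them has a small shadow.
   By Dirichlet's approximation theorem |A p - B q| is small for some
   bounded p, q, and the permutation exchanging the extreme digits of a
   mixed-radix expansion puts the cells along p q segments of slope p / q. *)

Require Import Defs.
From HB Require Import structures.
From mathcomp Require Import all_boot all_order all_algebra.
From mathcomp Require Import all_classical all_reals all_analysis.
From mathcomp Require Import zify ring lra.
Import Order.TTheory GRing.Theory Num.Theory.
Import numFieldNormedType.Exports.
Local Open Scope classical_set_scope.
Local Open Scope ring_scope.

(** * Permutation patterns and their products *)

(** Injectivity and [card_cell] together make [col] and [row] bijections onto the numbers below
    [side]. An abstract index type replaces a permutation, so that products and digit expansions can
    index their cells by tuples. *)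
Record pattern := Pattern {
  side : nat;
  cell : finType;
  col : cell -> nat;
  row : cell -> nat;
  side_gt0 : (0 < side)%N;
  col_lt : forall i, (col i < side)%N;
  row_lt : forall i, (row i < side)%N;
  col_inj : injective col;
  row_inj : injective row;
  card_cell : #|cell| = side }.

Arguments col {p} i.
Arguments row {p} i.

Lemma row_surj (P : pattern) (j : nat) :
  (j < side P)%N -> exists i : cell P, row i = j.
Proof.
move=> jlt.
have finj : injective (fun i : cell P => Ordinal (row_lt P i)).
  by move=> i i' /(congr1 val) /= /row_inj.
have := inj_card_onto finj _ (Ordinal jlt).
rewrite card_cell card_ord => /(_ (leqnn _)) /codomP [i /(congr1 val) /= ->].
by exists i.
Qed.

Lemma mixed_radix_inj (k a b a' b' : nat) :
  (b < k)%N -> (b' < k)%N -> (a * k + b = a' * k + b')%N -> a = a' /\ b = b'.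
Proof.
move=> bk b'k e.
have k0 : (0 < k)%N by lia.
have := congr1 (divn^~ k) e; have := congr1 (modn^~ k) e.
by rewrite !modnMDl !divnMDl // !modn_small // !divn_small // !addn0.
Qed.

Lemma mixed_radix_lt (m k a b : nat) :
  (a < m)%N -> (b < k)%N -> (a * k + b < m * k)%N.
Proof. nia. Qed.

(** Every cell of [P] is filled with a copy of [Q] shrunk by the factor [side P]. *)
Definition prod_pattern (P Q : pattern) : pattern.
Proof.
refine (@Pattern (side P * side Q) (cell P * cell Q)%type
  (fun i => col i.1 * side Q + col i.2)%N
  (fun i => row i.1 * side Q + row i.2)%N _ _ _ _ _ _).
- by rewrite muln_gt0 !side_gt0.
- by move=> i; apply: mixed_radix_lt; exact: col_lt.
- by move=> i; apply: mixed_radix_lt; exact: row_lt.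
- move=> [i j] [i' j'] /= /mixed_radix_inj [||/col_inj -> /col_inj -> //];
  exact: col_lt.
- move=> [i j] [i' j'] /= /mixed_radix_inj [||/row_inj -> /row_inj -> //];
  exact: row_lt.
- by rewrite card_prod !card_cell.
Defined.

(** The pattern is turned upside down, to serve the negative slopes. *)
Definition flip_pattern (P : pattern) : pattern.
Proof.
refine (@Pattern (side P) (cell P) col (fun i => side P - (row i).+1)%N
  (side_gt0 P) (col_lt P) _ (@col_inj P) _ (card_cell P)).
- by move=> i; have := row_lt P i; lia.
- move=> i j e; apply: row_inj; have := row_lt P i; have := row_lt P j; lia.
Defined.

Definition id_pattern : pattern.
Proof.
refine (@Pattern 1 unit (fun=> 0%N) (fun=> 0%N) _ _ _ _ _ card_unit) => //.
- by move=> [] [].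
- by move=> [] [].
Defined.

(* With [a], [l], [b] ranging over p, n, q values, the digits (a, l, b) of the
   column are reversed to form the row: for large n the cells gather along
   p * q segments of slope p / q. *)
Definition slope_pattern (p n q : nat) : pattern.
Proof.
refine (@Pattern (p.+1 * n.+1 * q.+1) ('I_p.+1 * 'I_n.+1 * 'I_q.+1)%type
  (fun i => (i.1.1 * n.+1 + i.1.2) * q.+1 + i.2)%N
  (fun i => (i.2 * n.+1 + i.1.2) * p.+1 + i.1.1)%N _ _ _ _ _ _).
- by [].
- by move=> i; apply: mixed_radix_lt => //; apply: mixed_radix_lt.
- move=> i; rewrite [ltnRHS](_ : _ = (q.+1 * n.+1 * p.+1)%N); last first.
    lia.
  by apply: mixed_radix_lt => //; apply: mixed_radix_lt.
- move=> [[a l] b] [[a' l'] b'] /=.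
  move=> /mixed_radix_inj [//|//|].
  by move=> /mixed_radix_inj [//|//|] /val_inj -> /val_inj -> /val_inj ->.
- move=> [[a l] b] [[a' l'] b'] /=.
  move=> /mixed_radix_inj [//|//|].
  by move=> /mixed_radix_inj [//|//|] /val_inj -> /val_inj -> /val_inj ->.
- by rewrite !card_prod !card_ord.
Defined.

(** * Shadows of patterns and their covers by intervals *)

Section shadows.
Variable R : realType.

(** The offsets [u] and [v] are independent: this is the shadow of the full closed cells, not only
    of their diagonals, so it can only shrink when a pattern is substituted in the cells. *)
Definition shadow (P : pattern) (A B : R) : set R :=
  [set z | exists i : cell P, exists u v : R,
    [/\ 0 <= u <= 1, 0 <= v <= 1 &
     z = A * (((row i)%:R + v) / (side P)%:R)
         - B * (((col i)%:R + u) / (side P)%:R)]].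

(** With one common radius the total length is a product, easy to follow under scaling and
    repetition. *)
Definition thin (S : set R) (L : R) : Prop :=
  exists (cs : seq R) (rho : R),
    [/\ 0 <= rho, (size cs)%:R * (2 * rho) <= L
      & forall z, S z -> exists2 c, c \in cs & `|z - c| <= rho].

Lemma thinS (S S' : set R) (L : R) : S `<=` S' -> thin S' L -> thin S L.
Proof.
move=> SS' [cs [rho [rho0 szL cover]]]; exists cs, rho; split => // z /SS'.
exact: cover.
Qed.

Lemma le_thin (S : set R) (L L' : R) : L <= L' -> thin S L -> thin S L'.
Proof.
move=> LL' [cs [rho [rho0 szL cover]]]; exists cs, rho; split => //.
exact: le_trans LL'.
Qed.

Lemma thin_translate (S S' : set R) (a L : R) :
  (forall z, S z -> S' (z - a)) -> thin S' L -> thin S L.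
Proof.
move=> SS' [cs [rho [rho0 szL cover]]].
exists [seq a + c | c <- cs], rho; split => //; first by rewrite size_map.
move=> z /SS' /cover [c ccs cz]; exists (a + c); first exact: map_f.
by rewrite opprD addrA.
Qed.

(** As [u] is strictly between 0 and 1, no carry occurs even if [v] is 0 or 1. This separates a
    point inside one mirror from the other closed mirrors. *)
Lemma natD_eq (k l : nat) (u v : R) : 0 < u < 1 -> 0 <= v <= 1 ->
  k%:R + u = l%:R + v -> k = l /\ u = v.
Proof.
move=> u01 v01 e.
have kl : (k < l.+1)%N by rewrite -(ltr_nat R) -natr1; lra.
have lk : (l < k.+1)%N by rewrite -(ltr_nat R) -natr1; lra.
have kl' : k = l by lia.
by split => //; move: e; rewrite kl' => /addrI.
Qed.

Lemma sideR_gt0 (P : pattern) : 0 < (side P)%:R :> R.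
Proof. by rewrite ltr0n side_gt0. Qed.

Lemma subcell01 (k n : nat) (u : R) : (k < n)%N -> 0 <= u <= 1 ->
  0 <= (k%:R + u) / n%:R <= 1.
Proof.
move=> kn /andP[u0 u1].
have n0 : 0 < n%:R :> R by rewrite ltr0n; lia.
have kn' : k%:R + 1 <= n%:R :> R by rewrite natr1 ler_nat.
apply/andP; split; first by rewrite divr_ge0 ?addr_ge0.
by rewrite ler_pdivrMr // mul1r; apply: le_trans kn'; rewrite lerD2l.
Qed.

Lemma shadow_prodl (P Q : pattern) (A B : R) :
  shadow (prod_pattern P Q) A B `<=` shadow P A B.
Proof.
move=> z [[i j] [u [v [u01 v01 ->]]]] /=.
exists i, (((col j)%:R + u) / (side Q)%:R), (((row j)%:R + v) / (side Q)%:R).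
split; [exact/subcell01/u01/col_lt|exact/subcell01/v01/row_lt|].
rewrite !natrD !natrM.
have := sideR_gt0 P; have := sideR_gt0 Q => /lt0r_neq0 Q0 /lt0r_neq0 P0.
by field; rewrite P0 Q0.
Qed.

(** The shadow of the product consists of [side P] translates of the shadow of [Q] shrunk by the
    factor [side P], so the total length is unchanged. *)
Lemma thin_prodr (P Q : pattern) (A B L : R) :
  thin (shadow Q A B) L -> thin (shadow (prod_pattern P Q) A B) L.
Proof.
move=> [cs [rho [rho0 szL cover]]].
have P0 := sideR_gt0 P; have Q0 := sideR_gt0 Q.
pose N : R := (side P)%:R.
exists [seq (A * (row i)%:R - B * (col i)%:R) / N + c / N
       | i <- enum (cell P), c <- cs], (rho / N); split.
- by rewrite divr_ge0 // ltW.
- rewrite size_allpairs -cardE card_cell natrM.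
  suff -> : (side P)%:R * (size cs)%:R * (2 * (rho / N))
    = (size cs)%:R * (2 * rho) by [].
  by rewrite /N; field; rewrite lt0r_neq0.
move=> z [[i j] [u [v [u01 v01 ->]]]] /=.
have [|c ccs cz] := cover (A * (((row j)%:R + v) / (side Q)%:R)
         - B * (((col j)%:R + u) / (side Q)%:R)).
  by exists j, u, v.
exists ((A * (row i)%:R - B * (col i)%:R) / N + c / N).
  by apply/allpairsP; exists (i, c); rewrite mem_enum.
rewrite [X in `|X|](_ : _ = ((A * (((row j)%:R + v) / (side Q)%:R)
         - B * (((col j)%:R + u) / (side Q)%:R)) - c) / N).
  by rewrite normrM normfV (ger0_norm (ltW P0)) ler_pM2r // invr_gt0.
by rewrite /N !natrD !natrM; field; rewrite !lt0r_neq0.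
Qed.

(** Putting 1 - y for y in A y - B x gives A + ((- A) y - B x), a translate. *)
Lemma thin_flip (P : pattern) (A B L : R) :
  thin (shadow P (- A) B) L -> thin (shadow (flip_pattern P) A B) L.
Proof.
apply: (@thin_translate _ _ A) => z [i [u [v [u01 v01 ->]]]] /=.
exists i, u, (1 - v); split => //; first lra.
have P0 := sideR_gt0 P.
rewrite natrB ?row_lt // -natr1.
by field; rewrite lt0r_neq0.
Qed.

(** Write p, n, q for the three radices. The digits (a, l, b) put the cell near (a / p, b / q) + (l
    / n) (1 / p, 1 / q). Along such a segment A y - B x drifts by at most |D|, the remaining digits
    contribute at most 2 C / n, and there are p q segments. *)
Lemma thin_slope (p n q : nat) (A B C : R) : `|A| <= C -> `|B| <= C ->
  thin (shadow (slope_pattern p n q) A B)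
    (2 * `|A * p.+1%:R - B * q.+1%:R| + 4 * C * p.+1%:R * q.+1%:R / n.+1%:R).
Proof.
move=> AC BC.
pose D := (A * p.+1%:R - B * q.+1%:R) / (p.+1%:R * q.+1%:R).
have p0 : 0 < p.+1%:R :> R by []; have q0 : 0 < q.+1%:R :> R by [].
have n0 : 0 < n.+1%:R :> R by [].
have C0 : 0 <= C by exact: le_trans AC.
(* The centre is the value of A y - B x at the start of the segment (a, b). *)
pose c (a b : nat) := A * b%:R / q.+1%:R - B * a%:R / p.+1%:R.
exists [seq c a b | a <- iota 0 p.+1, b <- iota 0 q.+1],
  (`|D| + 2 * C / n.+1%:R).
split.
- by rewrite addr_ge0 ?divr_ge0 ?mulr_ge0.
- rewrite size_allpairs !size_iota natrM /D normrM normfV.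
  rewrite (ger0_norm (ltW (mulr_gt0 p0 q0))).
  by rewrite le_eqVlt; apply/orP; left; apply/eqP; field; rewrite !lt0r_neq0.
move=> z [[[a l] b] [u [v [u01 v01 ->]]]].
exists (c a b); first by apply: allpairs_f; rewrite mem_iota /= ltn_ord.
move=> /=.
rewrite [X in `|X|](_ : _ = l%:R / n.+1%:R * D
   + (A * ((a%:R + v) / p.+1%:R) / q.+1%:R
      - B * ((b%:R + u) / q.+1%:R) / p.+1%:R) / n.+1%:R); last first.
  by rewrite /c /D !natrD !natrM !natrD !natrM; field; rewrite !lt0r_neq0.
apply: le_trans (ler_normD _ _) _; apply: lerD.
  rewrite normrM ler_piMl // ger0_norm ?divr_ge0 //.
  by rewrite ler_pdivrMr // mul1r ler_nat ltnW.
rewrite normrM normfV (ger0_norm (ltW n0)) ler_pM2r ?invr_gt0 //.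
have bound (X w : R) (k : nat) : `|X| <= C -> 0 <= w <= 1 ->
    `|X * w / k.+1%:R| <= C.
  move=> XC /andP[w0 w1]; rewrite !normrM normfV (ger0_norm w0) normr_nat.
  rewrite ler_pdivrMr // ler_pM // ?mulr_ge0 //.
  by rewrite (le_trans w1) // ler1n.
apply: le_trans (ler_normB _ _) _.
rewrite (_ : 2 * C = C + C); last by ring.
rewrite lerD // bound //; exact: subcell01.
Qed.

(** A right factor passes its thinness to the product by repetition, a left factor by inclusion, so
    an iterated product is as thin as each of its factors. *)
Lemma common_refinement (T : eqType) (F : T -> pattern) (s : seq T) :
  exists P : pattern, forall t A B L, t \in s ->
    thin (shadow (F t) A B) L -> thin (shadow P A B) L.
Proof.
elim: s => [|t s [P IH]]; first by exists id_pattern.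
exists (prod_pattern P (F t)) => t' A B L; rewrite inE => /predU1P[->|t's].
  exact: thin_prodr.
by move=> /IH -/(_ t's); apply: thinS; exact: shadow_prodl.
Qed.

(** * Diophantine approximation and the choice of the pattern *)

(** Pigeonhole: the fractional parts of the m + 2 multiples k s, k <= m + 1, fall in m + 1 boxes of
    length 1 / (m + 1). Two of them share a box, and q is the difference of their indices. *)
Lemma dirichlet_approximation (s : R) (m : nat) :
  exists (q : nat) (p : int), (0 < q <= m.+1)%N /\
    `|q%:R * s - p%:~R| < m.+1%:R^-1.
Proof.
have m0 : 0 < m.+1%:R :> R by [].
pose fr (k : nat) : R := k%:R * s - (Num.floor (k%:R * s))%:~R.
have fr01 k : 0 <= fr k < 1.
  have /andP[] := floor_itv (k%:R * s).
  by rewrite intrD /fr subr_ge0 ltrBlDl => -> ->.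
pose f (k : 'I_m.+2) : nat := Num.truncn (m.+1%:R * fr k).
have fE k : (f k)%:R <= m.+1%:R * fr k < (f k).+1%:R.
  by apply: truncn_itv; have /andP[h _] := fr01 k; rewrite mulr_ge0.
have flt k : (f k < m.+1)%N.
  rewrite -(ltr_nat R); have /andP[h _] := fE k; apply: le_lt_trans h _.
  by rewrite -ltr_pdivlMl // mulVf ?lt0r_neq0 //; have /andP[] := fr01 k.
have : ~~ injectiveb (fun k => Ordinal (flt k)).
  apply/negP => /injectiveP /leq_card; by rewrite !card_ord ltnn.
move=> /injectivePn [i [j ij /(congr1 val) /= fij]].
wlog ltij : i j ij fij / (i < j)%N.
  move=> H; case: (ltngtP i j) => [|ji|/val_inj e]; first exact: H.
    by apply: (H j i) => //; rewrite eq_sym.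
  by rewrite e eqxx in ij.
exists (j - i)%N, (Num.floor (j%:R * s) - Num.floor (i%:R * s)); split.
  by have := ltn_ord j; lia.
rewrite natrB 1?ltnW // intrB.
rewrite [X in `|X|](_ : _ = fr j - fr i); last by rewrite /fr; ring.
rewrite -(ltr_pM2l m0) mulfV ?lt0r_neq0 // -{1}(ger0_norm (ltW m0)) -normrM.
have := fE i; have := fE j; rewrite fij -[(f j).+1%:R]natr1.
move: (fr i) (fr j) => a b /andP[h1 h2] /andP[h3 h4].
by rewrite (mulrBr _ b a) ltr_norml; lra.
Qed.

(** Approximating B / A gives p and q bounded in terms of C, d and L only, so finitely many slope
    patterns and their flips serve all pairs (A, B). *)
Lemma exists_thin_pattern (C d L : R) : 0 < C -> 0 < d -> 0 < L ->
  exists P : pattern, forall A B : R, d <= `|A| <= C -> d <= `|B| <= C ->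
    thin (shadow P A B) L.
Proof.
move=> C0 d0 L0.
have bnd (x : R) : 0 <= x -> x < (Num.bound x)%:R by exact: archi_boundP.
(* The error C / (m + 1) has to be at most L / 4, as it counts twice in [thin_slope], and below d,
   which rules out p = 0. *)
pose m := (Num.bound (4 * C / L) + Num.bound (C / d))%N.
have mL : C / m.+1%:R <= L / 4.
  have h : 4 * C / L < m.+1%:R.
    apply: lt_le_trans (bnd _ _) _; first by rewrite divr_ge0 ?mulr_ge0 ?ltW.
    by rewrite ler_nat /m; lia.
  rewrite ler_pdivrMr // mulrAC ler_pdivlMr // mulrC [leRHS]mulrC.
  by rewrite -ler_pdivrMr // ltW.
have md : C / m.+1%:R < d.
  have h : C / d < m.+1%:R.
    apply: lt_le_trans (bnd _ _) _; first by rewrite divr_ge0 ?ltW.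
    by rewrite ler_nat /m; lia.
  by rewrite ltr_pdivrMr // mulrC -ltr_pdivrMr.
(* [k] bounds |p|, because |p| <= q |B / A| + 1 with q <= m + 1 and |B / A| <= C / d. Then [n]
   brings the second term of [thin_slope] down to L / 2. *)
pose k := Num.bound (m.+1%:R * C / d + 1).
pose n := Num.bound (8 * C * k%:R * m.+1%:R / L).
have nL : 4 * C * k%:R * m.+1%:R / n.+1%:R <= L / 2.
  rewrite ler_pdivrMr // [leRHS]mulrC -ler_pdivrMr ?divr_gt0 //.
  rewrite (_ : _ / (L / 2) = 8 * C * k%:R * m.+1%:R / L); last first.
    by field; rewrite lt0r_neq0.
  rewrite ltW // (lt_trans (bnd _ _)) ?ltr_nat //.
  by rewrite divr_ge0 ?mulr_ge0 // ltW.
(* The index holds the sign of p and the predecessors of |p| and q. *)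
pose F (t : bool * 'I_k * 'I_m.+1) :=
  if t.1.1 then flip_pattern (slope_pattern t.1.2 n t.2)
  else slope_pattern t.1.2 n t.2.
have [P HP] := common_refinement _ F (enum {: bool * 'I_k * 'I_m.+1}).
exists P => A B /andP[dA AC] /andP[dB BC].
have A0 : 0 < `|A| by exact: lt_le_trans dA.
have [q [p [/andP[q0 qm] apx]]] := dirichlet_approximation (B / A) m.
have apx' : `|q%:R * B - p%:~R * A| < C / m.+1%:R.
  have -> : q%:R * B - p%:~R * A = A * (q%:R * (B / A) - p%:~R).
    by field; rewrite -normr_gt0.
  rewrite normrM; apply: (@lt_le_trans _ _ (`|A| / m.+1%:R)).
    by rewrite ltr_pM2l.
  by rewrite ler_pM2r // invr_gt0.
have pk : (absz p < k.+1)%N.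
  rewrite -(ltr_nat R) natr_absz intr_norm.
  have h1 : `|p%:~R| <= m.+1%:R * C / d + 1 :> R.
    rewrite -[p%:~R](subKr (q%:R * (B / A))).
    apply: le_trans (ler_normB _ _) _; apply: lerD.
      rewrite normrM normr_nat -mulrA ler_pM // ?ler_nat //.
      by rewrite normrM normfV ler_pM // lef_pV2 ?posrE.
    by rewrite (le_trans (ltW apx)) // invf_le1 // ler1n.
  apply: le_lt_trans h1 _; apply: lt_trans (bnd _ _) _.
    by rewrite addr_ge0 // divr_ge0 ?mulr_ge0 // ltW.
  by rewrite ltr_nat.
case: q q0 qm apx apx' => // q _ qm _ apx.
have lenL (i : nat) x : (i < k)%N -> x < C / m.+1%:R ->
    2 * x + 4 * C * i.+1%:R * q.+1%:R / n.+1%:R <= L.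
  move=> ik xm.
  have : 4 * C * i.+1%:R * q.+1%:R / n.+1%:R <= L / 2.
    apply: le_trans nL; rewrite ler_pM2r ?invr_gt0 //.
    rewrite ler_pM // ?ler_nat // ?mulr_ge0 //.
    by rewrite ltW.
  by rewrite ler_pM2l ?mulr_gt0 // ler_nat.
  move: (C / _) (_ * q.+1%:R / _) mL xm => c y; lra.
case: p pk apx => [[|p]|p] pk apx.
(* p = 0 would give q |B| < C / (m + 1) < d <= |B|. *)
- exfalso; move: apx; rewrite mul0r subr0 normrM normr_nat ltNge.
  rewrite (le_trans (ltW md)) // (le_trans dB) // ler_peMl //.
  by rewrite ler1n.
- apply: (HP (false, Ordinal (pk : (p < k)%N), Ordinal qm) A B L).
    by rewrite mem_enum.
  rewrite /F /=; apply: le_thin (thin_slope _ _ _ _ _ _ AC BC).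
  by apply: lenL => //; rewrite distrC mulrC [A * _]mulrC.
(* For negative p the flip replaces A by - A, and (- A) |p| = A p. *)
- apply: (HP (true, Ordinal (pk : (p < k)%N), Ordinal qm) A B L).
    by rewrite mem_enum.
  rewrite /F /=; apply: thin_flip; rewrite -normrN in AC.
  apply: le_thin (thin_slope _ _ _ _ _ _ AC BC).
  apply: lenL => //; move: apx; rewrite NegzE -normrN.
  by congr (`|_| < _); rewrite rmorphN /=; ring.
Qed.

(** An outer measure is monotone on all sets, measurable or not. *)
Lemma lebesgue_measure_le (S U : set R) : S `<=` U ->
  (lebesgue_measure S <= lebesgue_measure U)%E.
Proof. exact: (@le_outer_measure _ _ (mu_ext (wlength idfun)) S U). Qed.

Lemma thin_measure (S : set R) (L : R) : thin S L ->
  (lebesgue_measure S <= L%:E)%E.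
Proof.
move=> [cs [rho [rho0 szL cover]]].
apply: (@le_trans _ _ ((size cs)%:R * (2 * rho))%:E); last by rewrite lee_fin.
pose I (c : R) : set R := `[c - rho, c + rho]%classic.
apply: (@le_trans _ _ (lebesgue_measure (\big[setU/set0]_(c <- cs) I c))).
  apply: lebesgue_measure_le => z /cover [c ccs czrho].
  rewrite -bigcup_seq; exists c => //=.
  by rewrite /I /= in_itv /=; move: czrho; rewrite ler_norml; lra.
elim: cs {szL cover} => [|c cs IH]; first by rewrite big_nil measure0 mul0r.
rewrite big_cons.
apply: le_trans (measureU2 _ _ _) _.
- exact: measurable_itv.
- by apply: bigsetU_measurable => i _; exact: measurable_itv.
rewrite /= -natr1 mulrDl mul1r addrC EFinD; apply: leeD => //.
(* For [rho] = 0 the interval is a point and the formula returns 0. *)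
rewrite /I lebesgue_measure_itv /= lte_fin; case: ifP => _.
  by rewrite -EFinB lee_fin; lra.
by rewrite lee_fin mulr_ge0.
Qed.

End shadows.

Arguments shadow {R} P A B _.
Arguments thin {R} S L.

(** * Light rays between reflections *)

Section light_rays.
Variable R : realType.
Implicit Types (G : seq (mirror R)) (gam : R -> plane R).

Lemma near0_rightP (P : R -> Prop) : (\forall h \near 0^'+, P h) <->
  exists2 e : R, 0 < e & forall h, 0 < h < e -> P h.
Proof.
split=> [[e /= e0 he]|[e e0 he]].
  exists e => // h /andP[h0 h1]; apply: he => //=.
  by rewrite sub0r normrN gtr0_norm.
by near=> h; apply: he; apply/andP; split.
Unshelve. all: by end_near. Qed.

Lemma velocity_before_unique {gam t v v'} :
  velocity_before gam t v -> velocity_before gam t v' -> v = v'.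
Proof.
move=> hv hv'; have [e e0 he] := (near0_rightP _).1 (filterI hv hv').
have e20 : 0 < e / 2 by rewrite divr_gt0.
have [|/= h h'] := he (e / 2); first by lra.
by move: h; rewrite h' => /addrI /oppr_inj /(scalerI (lt0r_neq0 e20)) ->.
Qed.

Lemma velocity_after_unique {gam t v v'} :
  velocity_after gam t v -> velocity_after gam t v' -> v = v'.
Proof.
move=> hv hv'; have [e e0 he] := (near0_rightP _).1 (filterI hv hv').
have e20 : 0 < e / 2 by rewrite divr_gt0.
have [|/= h h'] := he (e / 2); first by lra.
by move: h; rewrite h' => /addrI /(scalerI (lt0r_neq0 e20)) ->.
Qed.

Lemma continuous_eq_itv_oo (f g : R -> plane R) (a b : R) :
  continuous f -> continuous g -> a < b ->
  (forall x, a < x < b -> f x = g x) -> f a = g a /\ f b = g b.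
Proof.
move=> cf cg ab fg; split.
  apply: (@cvg_unique _ _ (f @ a^'+)).
  - exact: norm_hausdorff.
  - by apply: cvg_at_right_filter; exact: cf.
  - apply: (@cvg_trans _ (g x @[x --> a^'+])); last first.
    by apply: cvg_at_right_filter; exact: cg.
    apply: near_eq_cvg; near=> x; apply/esym/fg; apply/andP; split.
      by near: x; exact: nbhs_right_gt.
    by near: x; exact: nbhs_right_lt.
apply: (@cvg_unique _ _ (f @ b^'-)).
- exact: norm_hausdorff.
- by apply: cvg_at_left_filter; exact: cf.
- apply: (@cvg_trans _ (g x @[x --> b^'-])); last first.
    by apply: cvg_at_left_filter; exact: cg.
  apply: near_eq_cvg; near=> x; apply/esym/fg; apply/andP; split.
    by near: x; exact: nbhs_left_gt.
  by near: x; exact: nbhs_left_lt.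
Unshelve. all: by end_near. Qed.

Lemma continuous_line (p v : plane R) (a : R) :
  continuous (fun t : R => p + (t - a) *: v).
Proof.
move=> t; apply: cvgD; first exact: cvg_cst.
apply: cvgZr_tmp; apply: cvgB; [exact: cvg_id|exact: cvg_cst].
Qed.

(** If [I] meets every right neighbourhood of t, it has points beyond t arbitrarily close to t, and
    convexity fills the gaps. *)
Lemma interval_near_right (I : set R) (t : R) : is_interval I ->
  (\forall h \near 0^'+, I (t + h)) \/ (\forall h \near 0^'+, ~ I (t + h)).
Proof.
move=> Ii; case: (pselect (\forall h \near 0^'+, ~ I (t + h))) => H.
  by right.
left.
have H1 e : 0 < e -> exists h, 0 < h < e /\ I (t + h).
  move=> e0; apply: contrapT => H2; apply: H; apply/near0_rightP.
  by exists e => // h h0 Ih; apply: H2; exists h.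
have [e [/andP[e0 _] Ie]] := H1 1 ltr01.
apply/near0_rightP; exists e => // h /andP[h0 he].
have [h' [/andP[h'0 h'h] Ih']] := H1 h h0.
by apply: (Ii _ _ Ih' Ie); rewrite !lerD2l !ltW.
Qed.

(** Of finitely many intervals covering the line, one contains a right neighbourhood of t. The time
    t itself may lie in another piece, so continuity carries the affine formula to it. *)
Lemma velocity_after_exists gam t : continuous gam ->
  unit_speed_piecewise_affine gam -> exists v, velocity_after gam t v.
Proof.
move=> cgam [n [I [[cov _ _] Iitv aff]]].
have [i /near0_rightP [e e0 Ie]] :
    exists i, \forall h \near 0^'+, I i (t + h).
  apply: contrapT => H.
  have H1 : forall i, \forall h \near 0^'+, ~ I i (t + h).
    move=> i; case: (interval_near_right _ t (Iitv i)) => // Hi.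
    by case: H; exists i.
  have [h Hh] := filter_ex (filter_forall _ H1).
  have : [set: R] (t + h) by [].
  by rewrite -cov => -[i _ /Hh].
have [v [w [t1 [_ gamE]]]] := aff i; exists v.
have lineE s : Gamma v w (s - t1) = w + (s - t1) *: v by rewrite /Gamma addrC.
have [gamt _] : gam t = w + (t - t1) *: v
    /\ gam (t + e) = w + (t + e - t1) *: v.
  apply: (@continuous_eq_itv_oo _ (fun s => w + (s - t1) *: v)) => //.
  - exact: continuous_line.
  - by rewrite ltrDl.
  - move=> x /andP[tx xe]; rewrite gamE ?lineE // -[x](subrKC t).
    by apply: Ie; rewrite subr_gt0 tx ltrBlDl.
apply/near0_rightP; exists e => // h he.
by rewrite gamE ?lineE; [rewrite gamt addrAC scalerDl addrA|exact: Ie].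
Qed.

(** Continuous induction on the time up to which the ray follows the line. Mirrors are excluded only
    strictly between a and b, since the ray may start on the mirror that has just reflected it. *)
Lemma ray_straight G gam (a b : R) (p v : plane R) :
  light_ray G gam -> gam a = p -> velocity_after gam a v ->
  (forall t, a < t < b -> ~ mirrors_union G (p + (t - a) *: v)) ->
  forall t, a <= t <= b -> gam t = p + (t - a) *: v.
Proof.
move=> [cgam aff _ free _] gama va noG t0 /andP[at0 t0b].
apply: contrapT => bad.
pose S := [set t | a <= t <= t0
  /\ forall u, a <= u <= t -> gam u = p + (u - a) *: v].
have Sa : S a.
  split; first by rewrite lexx.
  move=> u /le_anti <-; by rewrite subrr scale0r addr0.
have Sub : ubound S t0 by move=> x [/andP[]].
have supS : has_sup S by split; [exists a|exists t0].
have a_tau : a <= sup S by apply: (sup_upper_bound supS).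
have tau_t0 : sup S <= t0 by apply: ge_sup => //; exists a.
set tau := sup S in a_tau tau_t0.
have below u : a <= u < tau -> gam u = p + (u - a) *: v.
  move=> /andP[au utau].
  have [s [_ Ss] us] := sup_gt (ex_intro _ a Sa) utau.
  by apply: Ss; rewrite au ltW.
have gamtau : gam tau = p + (tau - a) *: v.
  move: a_tau; rewrite le_eqVlt => /predU1P[<-|a_tau].
    by rewrite subrr scale0r addr0.
  have [] // := @continuous_eq_itv_oo gam (fun s => p + (s - a) *: v) a tau.
    exact: continuous_line.
  by move=> x /andP[ax xt]; apply: below; rewrite (ltW ax).
have tau_lt : tau < t0.
  by rewrite lt_neqAle tau_t0 andbT; apply/eqP => e; rewrite -e in bad.
(* At the supremum the ray still leaves with velocity v: by hypothesis if [tau] = a, and otherwise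
   because [gam tau] is off the mirrors. *)
have vtau : velocity_after gam tau v.
  move: a_tau; rewrite le_eqVlt => /predU1P[<- //|a_tau].
  have [v' hv'] := velocity_after_exists gam tau cgam aff.
  have hv : velocity_before gam tau v.
    apply/near0_rightP; exists (tau - a); first by rewrite subr_gt0.
    move=> h /andP[h0 h1]; rewrite below ?gamtau.
      by rewrite (_ : tau - h - a = (tau - a) - h) ?scalerBl ?addrA //; ring.
    by rewrite ltrBlDr ltrDl h0 andbT; lra.
  suff <- : v' = v by [].
  apply: (free tau) => //; rewrite gamtau; apply: noG.
  by rewrite a_tau (lt_le_trans tau_lt).
have [e e0 he] := (near0_rightP _).1 vtau.
(* The ray thus follows the line a little longer, against the choice of [tau]. *)
have [d [d0 de dt]] : exists d, [/\ 0 < d, d < e & tau + d <= t0].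
  exists (Num.min (e / 2) (t0 - tau)); split.
  - by rewrite lt_min divr_gt0 // subr_gt0.
  - by rewrite gt_min; apply/orP; left; lra.
  - by rewrite -lerBrDl ge_min lexx orbT.
have : S (tau + d).
  split; first by rewrite dt andbT; lra.
  move=> u /andP[au ud].
  case: (ltgtP u tau) => [utau|utau|-> //].
    by apply: below; rewrite au.
  have -> : u = tau + (u - tau) by ring.
  rewrite he ?gamtau; last by lra.
  rewrite (_ : tau + (u - tau) - a = (tau - a) + (u - tau)) ?scalerDl ?addrA //.
  by ring.
move=> /(ub_le_sup (ex_intro _ _ Sub)); rewrite -/tau.
by rewrite gerDl leNgt d0.
Qed.

Lemma velocity_before_line (gam : R -> plane R) (a t : R) (p v : plane R) :
  a < t -> (forall s, a <= s <= t -> gam s = p + (s - a) *: v) ->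
  velocity_before gam t v.
Proof.
move=> at_ gamE; apply/near0_rightP; exists (t - a); first by rewrite subr_gt0.
move=> h /andP[h0 h1]; rewrite !gamE; [|lra|lra].
by rewrite (_ : t - h - a = (t - a) - h) ?scalerBl ?addrA //; ring.
Qed.

Lemma velocity_after_line (gam : R -> plane R) (t b : R) (p v : plane R) :
  t < b -> (forall s, t <= s <= b -> gam s = p + s *: v) ->
  velocity_after gam t v.
Proof.
move=> tb gamE; apply/near0_rightP; exists (b - t); first by rewrite subr_gt0.
move=> h /andP[h0 h1]; rewrite !gamE; [|lra|lra].
by rewrite scalerDl addrA.
Qed.

(** * Reflection at a single point *)

Section reflection_at_a_point.
Variables (G : seq (mirror R)) (s : mirror R) (v w v' w' H : plane R).
Variables (tau tau' : R).
Hypothesis vw : is_direction v w.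
Hypothesis vw' : is_direction v' w'.
Hypothesis HE : H = Gamma v w tau.
Hypothesis HE' : H = Gamma v' w' tau'.
Hypothesis sG : s \in G.
Hypothesis Hs : open_segment s H.
Hypothesis Honly : forall s', s' \in G -> segment s' H -> s' = s.
Hypothesis vv' : v' = reflect_along (s.2 - s.1) v.
Hypothesis free_before : forall t : R, t < 0 -> ~ mirrors_union G (H + t *: v).
Hypothesis free_after : forall t : R, 0 < t -> ~ mirrors_union G (H + t *: v').

(** The expected ray, timed to reach H at time 0; min and max make its continuity immediate. *)
Let broken (t : R) : plane R := H + Num.min t 0 *: v + Num.max t 0 *: v'.

Let broken_le0 t : t <= 0 -> broken t = H + t *: v.
Proof.
by move=> t0; rewrite /broken min_l // max_r // scale0r addr0.
Qed.

Let broken_ge0 t : 0 <= t -> broken t = H + t *: v'.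
Proof.
by move=> t0; rewrite /broken min_r // max_l // scale0r addr0.
Qed.

Let segment_H : segment s H.
Proof.
by have [x x01 <-] := Hs; exists x => //; apply: subset_itv_oo_cc.
Qed.

Let broken_continuous : continuous broken.
Proof.
move=> t; apply: cvgD.
  apply: cvgD; first exact: cvg_cst.
  apply: cvgZr_tmp; apply: continuous_min; [exact: cvg_id|exact: cvg_cst].
by apply: cvgZr_tmp; apply: continuous_max; [exact: cvg_id|exact: cvg_cst].
Qed.

Let broken_piecewise : unit_speed_piecewise_affine broken.
Proof.
have ord_max_eq (i : 'I_2) : i <> ord0 -> i = ord_max.
  by case: i => [[|[|//]] ?] i0; [case: i0; exact: val_inj|exact: val_inj].
exists 2%N, (fun i : 'I_2 =>
  if i == ord0 then `]-oo, 0]%classic else `]0, +oo[%classic).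
split.
- split.
  + apply/seteqP; split=> // x _; case: (leP x 0) => x0.
      by exists ord0 => //=; rewrite in_itv.
    by exists ord_max => //=; rewrite in_itv /= x0.
  + move=> i j _ _ [x []].
    case: eqP => i0; case: eqP => j0 /=; rewrite !in_itv /= ?andbT => h1 h2.
    * by rewrite i0 j0.
    * by have := le_lt_trans h1 h2; rewrite ltxx.
    * by have := le_lt_trans h2 h1; rewrite ltxx.
    * by rewrite (ord_max_eq _ i0) (ord_max_eq _ j0).
  + move=> i _; case: eqP => _; [exists 0|exists 1];
      rewrite /= in_itv /= ?lexx //.
    by rewrite ltr01.
- by move=> i; case: eqP => _; exact: interval_is_interval.
move=> i; case: eqP => _.
  exists v, w, (- tau); split => // t /=; rewrite in_itv /= => t0.
  by rewrite broken_le0 // HE /Gamma opprK scalerDl addrC addrA.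
exists v', w', (- tau'); split => // t /=; rewrite in_itv /= andbT => t0.
by rewrite broken_ge0 ?ltW // HE' /Gamma opprK scalerDl addrC addrA.
Qed.

Let hit_time t : mirrors_union G (broken t) -> t = 0.
Proof.
case: (ltgtP t 0) => // t0; [rewrite broken_le0|rewrite broken_ge0];
  rewrite ?ltW //.
  by move=> /(free_before _ t0).
by move=> /(free_after _ t0).
Qed.

Let broken0 : broken 0 = H.
Proof. by rewrite broken_le0 // scale0r addr0. Qed.

Let broken_before t : t <= 0 -> velocity_before broken t v.
Proof.
move=> t0; apply: (@velocity_before_line _ (t - 1) _ (H + (t - 1) *: v)).
  by rewrite gtrBl.
move=> u /andP[u1 u2]; rewrite broken_le0 ?(le_trans u2) //.
by rewrite -addrA -scalerDl; congr (_ + _ *: _); ring.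
Qed.

Let broken_after t : 0 <= t -> velocity_after broken t v'.
Proof.
move=> t0; apply: (@velocity_after_line _ _ (t + 1) H); first by rewrite ltrDl.
by move=> u /andP[u1 u2]; rewrite broken_ge0 // (le_trans t0).
Qed.

Let broken_light_ray : light_ray G broken.
Proof.
have hit s' t : s' \in G -> segment s' (broken t) -> t = 0 /\ s' = s.
  move=> s'G s'b; have t0 : t = 0 by apply: hit_time; exists s'.
  by split => //; apply: Honly => //; rewrite -broken0 -t0.
split => //.
- by move=> t s' s'G /hit[//|-> ->]; rewrite broken0.
- move=> t u u' hu hu' noG; case: (ltgtP t 0) => t0.
  + rewrite (velocity_before_unique hu (broken_before _ (ltW t0))).
    apply: (velocity_after_unique hu').
    apply: (@velocity_after_line _ _ 0 H) => // x /andP[_ x0].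
    exact: broken_le0.
  + rewrite (velocity_after_unique hu' (broken_after _ (ltW t0))).
    apply/esym; apply: (velocity_before_unique hu).
    apply: (@velocity_before_line _ 0 _ H) => // x /andP[x0 _].
    by rewrite subr0; exact: broken_ge0.
  + by case: noG; rewrite t0 broken0; exists s.
- move=> t u u' hu hu' s' s'G /hit[//|t0 ->]; rewrite t0 in hu hu'.
  rewrite (velocity_after_unique hu' (broken_after _ (lexx 0))).
  by rewrite (velocity_before_unique hu (broken_before _ (lexx 0))).
Qed.

Let broken_comes_from : comes_from broken v w.
Proof.
split => //; exists (- tau); exists 0; split; first exact: num_real.
move=> t t0; rewrite broken_le0 ?ltW // HE /Gamma opprK scalerDl.
by rewrite addrC addrA.
Qed.

(** Uniqueness up to a time shift: the incoming half meets no mirror and is straight, the law of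
    reflection fixes the velocity at H, and the outgoing half is straight again. *)
Let ray_is_broken gam : light_ray G gam -> comes_from gam v w ->
  exists t0, forall t, gam t = broken (t - t0).
Proof.
move=> ray [_ [t1 [M [_ gamE]]]].
(* The time at which the incoming line reaches H. *)
pose t0 := t1 + tau.
have GE (t : R) : Gamma v w (t - t1) = H + (t - t0) *: v.
  rewrite HE /Gamma /t0 addrAC -scalerDl; congr (_ *: _ + _); ring.
have start a : a < M -> gam a = H + (a - t0) *: v /\ velocity_after gam a v.
  move=> aM; split; first by rewrite gamE // GE.
  apply/near0_rightP; exists (M - a); first by rewrite subr_gt0.
  move=> h /andP[h0 h1]; rewrite !gamE // ?GE; last by lra.
  by rewrite (_ : a + h - t0 = (a - t0) + h) ?scalerDl ?addrA //; ring.
have before t : t <= t0 -> gam t = H + (t - t0) *: v.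
  move=> tt0; pose a := Num.min t (M - 1).
  have [|gama va] := start a.
    by rewrite /a gt_min; apply/orP; right; rewrite gtrBl.
  have lineE x : H + (a - t0) *: v + (x - a) *: v = H + (x - t0) *: v.
    by rewrite -addrA -scalerDl; congr (_ + _ *: _); ring.
  rewrite (@ray_straight G gam a t0 _ v ray gama va) ?lineE //.
    move=> x /andP[_ xt0]; rewrite lineE; apply: free_before.
    by rewrite subr_lt0.
  by rewrite tt0 andbT /a ge_min lexx.
have gamt0 : gam t0 = H by rewrite before // subrr scale0r addr0.
have vt0 : velocity_after gam t0 v'.
  have [cgam aff _ _ refl] := ray.
  have [u hu] := velocity_after_exists gam t0 cgam aff.
  suff <- : u = v' by [].
  rewrite vv'; apply: (refl t0) => //; last by rewrite gamt0.
  apply: (@velocity_before_line _ (t0 - 1) _ (H - v)); first by rewrite gtrBl.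
  move=> x /andP[_ xt0]; rewrite before // -[- v]scaleN1r -addrA -scalerDl.
  by congr (_ + _ *: _); ring.
have after t : t0 <= t -> gam t = H + (t - t0) *: v'.
  move=> tt0; apply: (@ray_straight G gam t0 t _ v' ray gamt0 vt0).
    move=> x /andP[t0x _]; apply: free_after.
    by rewrite subr_gt0.
  by rewrite tt0 lexx.
exists t0 => t; case: (leP t t0) => tt0.
  by rewrite before // broken_le0 // subr_le0.
by rewrite after ?ltW // broken_ge0 // subr_ge0 ltW.
Qed.

Lemma reflects_once_at_point gam : light_ray G gam -> comes_from gam v w ->
  reflects_once G gam.
Proof.
move=> ray from; have [t0 gamE] := ray_is_broken gam ray from.
exists t0; split; first by rewrite gamE subrr broken0; exists s.
by move=> t; rewrite gamE => /hit_time /subr0_eq.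
Qed.

Lemma transfer_at_point : transfer G (v, w) (v', w').
Proof.
split; first by exists broken.
move=> gam ray from; have [t0 gamE] := ray_is_broken gam ray from.
split => //; exists (t0 - tau'), t0; split; first exact: num_real.
move=> t tt0; rewrite gamE broken_ge0 ?subr_ge0 ?ltW // HE' /Gamma /=.
by rewrite addrAC -scalerDl; congr (_ *: _ + _); ring.
Qed.

End reflection_at_a_point.
End light_rays.

Arguments reflects_once_at_point {R G s v w v' H tau}.
Arguments transfer_at_point {R G s v w v' w' H tau tau'}.

(** * Trigonometry *)

Section trigonometry.
Variable R : realType.

Lemma cos2Dsin2 (a : R) : cos a ^+ 2 + sin a ^+ 2 = 1.
Proof. by rewrite cos2sin2 subrK. Qed.

Lemma dotpZl (a : R) (u v : plane R) : dotp (a *: u) v = a * dotp u v.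
Proof. by rewrite /dotp /= -![_ *: _]/(_ * _); ring. Qed.

Lemma dotp_expi (a : R) : dotp (expi a) (expi a) = 1.
Proof. by rewrite -(cos2Dsin2 a) /dotp !expr2. Qed.

(** The sine increases up to pi / 2 and is symmetric about it. *)
Lemma sin_lower_bound {e : R} : 0 < e ->
  exists2 d : R, 0 < d & forall x, e <= x <= pi - e -> d <= sin x.
Proof.
move=> e0; have pi2 : 0 < pi / 2 :> R by rewrite divr_gt0 ?pi_gt0.
(* The cap at pi / 2 keeps the bound positive when e is large and the range empty. *)
pose e' := Num.min e (pi / 2).
have e'0 : 0 < e' by rewrite lt_min e0.
have e'e : e' <= e by rewrite ge_min lexx.
have e'pi : e' <= pi / 2 by rewrite ge_min lexx orbT.
have half x : e' <= x <= pi / 2 -> sin e' <= sin x.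
  move=> /andP[x1 x2]; rewrite leNgt ltr_sin ?in_itv /=; first by lra.
    lra.
  lra.
exists (sin e'); first by apply: sin_gt0_pi; lra.
move=> x /andP[x1 x2]; case: (leP x (pi / 2)) => x3.
  by apply: half; lra.
have -> : sin x = sin (pi - x).
  by rewrite sinB sinpi cospi; ring.
by apply: half; lra.
Qed.

End trigonometry.

(** * Oblique coordinates and the mirrors *)

Section geometry.
Variables (R : realType) (theta : R).
Hypothesis theta_pi : 0 < theta < pi.

(* The point (x - 1) / sin theta + y / sin theta * e^{i theta} in oblique
   coordinates: horizontal lines are y = const, lines of direction theta are
   x = const, and slope 1 is the direction theta / 2. *)
Definition place (x y : R) : plane R :=
  ((x - 1 + y * cos theta) / sin theta, y).

Lemma sin_theta_gt0 : 0 < sin theta.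
Proof. exact: sin_gt0_pi. Qed.

Lemma sin_theta_neq0 : sin theta != 0.
Proof. exact: lt0r_neq0 sin_theta_gt0. Qed.

Lemma place_inj (x y x' y' : R) : place x y = place x' y' -> x = x' /\ y = y'.
Proof.
move=> [/(mulIf (invr_neq0 sin_theta_neq0)) e yy'].
by split => //; move: e; rewrite yy' => /addIr /addIr.
Qed.

Lemma place_affine (t x y x' y' : R) :
  (1 - t) *: place x y + t *: place x' y'
  = place ((1 - t) * x + t * x') ((1 - t) * y + t * y').
Proof.
rewrite /place; congr pair => /=.
by rewrite -![_ *: _]/(_ * _); field; exact: sin_theta_neq0.
Qed.

Lemma place_horizontal (x y t : R) :
  place x y + t *: (1, 0) = place (x + t * sin theta) y.
Proof.
rewrite /place; congr pair => /=; rewrite -![_ *: _]/(_ * _); last by ring.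
by field; exact: sin_theta_neq0.
Qed.

Lemma place_oblique (x y t : R) :
  place x y + t *: expi theta = place x (y + t * sin theta).
Proof.
rewrite /place; congr pair => /=; rewrite -![_ *: _]/(_ * _) //.
by field; exact: sin_theta_neq0.
Qed.

(** This links the mirrors to [shadow]: the coefficients of y and x are its A and B, and the
    constant is a translation. *)
Lemma dotp_place (x y phi : R) : dotp (place x y) (expi (phi + pi / 2))
  = y * sin (theta - phi) / sin theta - x * sin phi / sin theta
    + sin phi / sin theta.
Proof.
rewrite /dotp /= cosDpihalf sinDpihalf sinB.
by field; exact: sin_theta_neq0.
Qed.

Section mirrors.
Variable P : pattern.
Let N : R := (side P)%:R.

Definition cell_mirror (c : cell P) : mirror R :=
  (place ((col c)%:R / N) ((row c)%:R / N),
   place (((col c)%:R + 1) / N) (((row c)%:R + 1) / N)).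

Definition pattern_mirrors : seq (mirror R) :=
  [seq cell_mirror c | c <- enum (cell P)].

Let N_gt0 : 0 < N. Proof. exact: sideR_gt0. Qed.
Let N_neq0 : N != 0. Proof. exact: lt0r_neq0. Qed.

Lemma cell_mirror_point (c : cell P) (u : R) :
  (1 - u) *: (cell_mirror c).1 + u *: (cell_mirror c).2
  = place (((col c)%:R + u) / N) (((row c)%:R + u) / N).
Proof. by rewrite place_affine; congr place; field. Qed.

Lemma pattern_mirrors_pointP (p : plane R) : mirrors_union pattern_mirrors p ->
  exists (c : cell P) (u : R), 0 <= u <= 1 /\
    p = place (((col c)%:R + u) / N) (((row c)%:R + u) / N).
Proof.
move=> [s /mapP[c _ ->] [u /= u01 <-]].
by exists c, u; rewrite cell_mirror_point; rewrite in_itv in u01.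
Qed.

Lemma cell_mirror_nondegenerate (s : mirror R) :
  s \in pattern_mirrors -> s.1 <> s.2.
Proof.
move=> /mapP[c _ ->] /place_inj[/(mulIf (invr_neq0 N_neq0)) e _].
by have /eqP := e; rewrite -subr_eq0 opprD addNKr oppr_eq0 oner_eq0.
Qed.

(** * A ray through the interior of one mirror *)

Section one_cell.
Variables (c : cell P) (u : R).
Hypothesis u01 : 0 < u < 1.
Let x := ((col c)%:R + u) / N.
Let y := ((row c)%:R + u) / N.
Let H := place x y.

Let NI : injective (fun z : R => z / N).
Proof. exact: mulIf (invr_neq0 N_neq0). Qed.

(** The incoming path stays in the row of [c], the outgoing one in its column. Injectivity of [row]
    and [col] leaves no other mirror there, and [u] strictly inside takes care of the cell
    borders. *)
Let only_cell (c' : cell P) (v z : R) : 0 <= v <= 1 ->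
  (place x z = place (((col c')%:R + v) / N) (((row c')%:R + v) / N) \/
   place z y = place (((col c')%:R + v) / N) (((row c')%:R + v) / N)) ->
  c' = c /\ v = u.
Proof.
move=> v01 [] /place_inj[].
  by move=> /NI /natD_eq[]// /col_inj -> -> _.
by move=> _ /NI /natD_eq[]// /row_inj -> ->.
Qed.

Let free_horizontal (t : R) : t < 0 ->
  ~ mirrors_union pattern_mirrors (H + t *: (1, 0)).
Proof.
move=> t0 /pattern_mirrors_pointP [c' [v [v01]]].
rewrite place_horizontal => e.
have [ec ev] := only_cell c' v _ v01 (or_intror e).
move: e; rewrite ec ev => /place_inj[/eqP + _].
rewrite -subr_eq0 addrAC subrr add0r mulf_eq0 (negPf sin_theta_neq0) orbF.
by rewrite lt_eqF.
Qed.

Let free_oblique (t : R) : 0 < t ->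
  ~ mirrors_union pattern_mirrors (H + t *: expi theta).
Proof.
move=> t0 /pattern_mirrors_pointP [c' [v [v01]]].
rewrite place_oblique => e.
have [ec ev] := only_cell c' v _ v01 (or_introl e).
move: e; rewrite ec ev => /place_inj[_ /eqP].
rewrite -subr_eq0 addrAC subrr add0r mulf_eq0 (negPf sin_theta_neq0) orbF.
by rewrite gt_eqF.
Qed.

Let mirror_c : cell_mirror c \in pattern_mirrors.
Proof. by apply: map_f; rewrite mem_enum. Qed.

Let open_c : open_segment (cell_mirror c) H.
Proof. by exists u; [rewrite /= in_itv|exact: cell_mirror_point]. Qed.

Let only_c (s : mirror R) : s \in pattern_mirrors -> segment s H ->
  s = cell_mirror c.
Proof.
move=> /mapP[c' _ ->] [v /=]; rewrite in_itv /= => v01.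
rewrite cell_mirror_point => /esym e.
by have [-> _] := only_cell c' v _ v01 (or_introl e).
Qed.

(** The mirror vector k ((1 + cos theta) / sin theta, 1), with k = 1 / N, is a multiple of e^{i
    theta / 2}, and reflection in this direction turns the angle 0 into theta. *)
Let reflects : expi theta =
  reflect_along ((cell_mirror c).2 - (cell_mirror c).1) (1, 0).
Proof.
pose k : R := N^-1.
have k0 : k != 0 by rewrite invr_eq0.
have s0 := sin_theta_neq0.
have cs := cos2Dsin2 R theta.
have -> : (cell_mirror c).2 - (cell_mirror c).1
    = (k * (1 + cos theta) / sin theta, k).
  rewrite /cell_mirror /place; congr pair => /=; rewrite /k; field => //.
  by rewrite s0.
have c1 : 1 + cos theta != 0.
  apply/negP => /eqP h; have : sin theta ^+ 2 = 0.
    have -> : sin theta ^+ 2 = 1 - cos theta ^+ 2 by rewrite -cs; ring.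
    have -> : cos theta = - 1 by lra.
    by ring.
  by move=> /eqP; rewrite expf_eq0 /= (negPf s0).
rewrite /reflect_along.
have -> : 2 * dotp ((1, 0) : plane R) (k * (1 + cos theta) / sin theta, k)
   / dotp (k * (1 + cos theta) / sin theta, k)
          (k * (1 + cos theta) / sin theta, k) = sin theta / k.
  rewrite /dotp /= mul1r mul0r addr0.
  have -> : k * (1 + cos theta) / sin theta * (k * (1 + cos theta) / sin theta)
     + k * k = 2 * k ^+ 2 * (1 + cos theta) / sin theta ^+ 2.
    apply: (mulIf (expf_neq0 2 s0)); rewrite mulfVK ?expf_neq0 //.
    transitivity (k ^+ 2 * ((1 + cos theta) ^+ 2 + sin theta ^+ 2)).
      by field.
    have -> : sin theta ^+ 2 = 1 - cos theta ^+ 2 by rewrite -cs; ring.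
    by ring.
  by field; rewrite s0 k0 c1.
rewrite /expi; congr pair => /=; rewrite -![_ *: _]/(_ * _).
  by field; rewrite s0 k0.
by rewrite mulfVK // subr0.
Qed.

Let in_direction : is_direction ((1, 0) : plane R) (0, y).
Proof.
by split; rewrite /enorm /dotp /= !(mul0r, mulr0, mul1r, addr0, add0r) ?sqrtr1.
Qed.

(** The column x leaves with r = 1 - x, the component of H along e^{i (theta + pi / 2)}; the shift
    by 1 in [place] keeps r in [0, 1]. *)
Let out_direction :
  is_direction (expi theta) ((1 - x) *: expi (theta + pi / 2)).
Proof.
split; first by rewrite /enorm dotp_expi sqrtr1.
rewrite /dotp /= cosDpihalf sinDpihalf -![_ *: _]/(_ * _); ring.
Qed.

Let H_in : H = Gamma (1, 0) (0, y) H.1.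
Proof.
rewrite /Gamma; congr pair => /=; rewrite -![_ *: _]/(_ * _).
  by rewrite mulr1 addr0.
by rewrite mulr0 add0r.
Qed.

(** The time parameter is the component of H along e^{i theta}. *)
Let H_out : H = Gamma (expi theta) ((1 - x) *: expi (theta + pi / 2))
                  (((x - 1) * cos theta + y) / sin theta).
Proof.
have s0 := sin_theta_neq0; have cs := cos2Dsin2 R theta.
have c2 : cos theta ^+ 2 = 1 - sin theta ^+ 2 by rewrite -cs; ring.
rewrite /Gamma /H /place; congr pair => /=.
  rewrite cosDpihalf -![_ *: _]/(_ * _).
  apply: (mulIf s0); rewrite mulfVK // mulrDl.
  transitivity ((x - 1) * cos theta ^+ 2 + y * cos theta
                + (x - 1) * sin theta ^+ 2); last by field.
  by rewrite c2; ring.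
by rewrite sinDpihalf -![_ *: _]/(_ * _); field.
Qed.

Lemma cell_reflects_once gam : light_ray pattern_mirrors gam ->
  comes_from gam (1, 0) (0, y) -> reflects_once pattern_mirrors gam.
Proof.
exact: reflects_once_at_point H_in mirror_c open_c reflects
  free_horizontal free_oblique _.
Qed.

Lemma cell_transfer : transfer pattern_mirrors ((1, 0), (0, y))
  (expi theta, (1 - x) *: expi (theta + pi / 2)).
Proof.
exact: transfer_at_point in_direction out_direction H_in H_out
  mirror_c open_c only_c reflects free_horizontal free_oblique.
Qed.

End one_cell.

(** The excluded heights k / N, which include those of all mirror ends, form a countable set. Any
    other r is strictly inside one row, and this row holds exactly one cell. *)
Lemma ae_transfer : {ae lebesgue_measure, forall r : R, r \in `[0, 1] ->
   (forall gam, light_ray pattern_mirrors gam -> comes_from gam (1, 0) (0, r) ->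
      reflects_once pattern_mirrors gam) /\
   (exists2 vw, transfer pattern_mirrors ((1, 0), (0, r)) vw &
      exit_directions theta vw)}.
Proof.
exists [set k%:R / N | k in [set: nat]]; split.
- exact/countable_measurable/sub_countable/card_image_le.
- exact/countable_lebesgue_measure0/sub_countable/card_image_le.
move=> r /= bad; apply: contrapT => rN; apply: bad => r01.
pose k := Num.truncn (r * N).
have /andP[r0 r1] : 0 <= r <= 1 by move: r01; rewrite in_itv.
have kr : k%:R <= r * N < k.+1%:R.
  by apply: truncn_itv; rewrite mulr_ge0 // ltW.
pose u := r * N - k%:R.
have rE : r = (k%:R + u) / N by rewrite /u; field.
have u01 : 0 < u < 1.
  move: kr; rewrite -natr1 /u => /andP[h1 h2]; apply/andP; split; last by lra.
  rewrite lt_neqAle subr_ge0 h1 andbT; apply/eqP => u0.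
  by apply: rN; exists k => //; rewrite rE /u -u0 addr0.
have kN : (k < side P)%N.
  rewrite -(ltr_nat R) -/N.
  have : r * N <= N by rewrite ler_piMl // ltW.
  by move: u01; rewrite /u => /andP[? ?] ?; lra.
have [c ck] := row_surj _ _ kN.
rewrite rE -ck; split; first by move=> gam; apply: cell_reflects_once.
exists (expi theta, (1 - ((col c)%:R + u) / N) *: expi (theta + pi / 2)).
  exact: cell_transfer.
exists (1 - ((col c)%:R + u) / N) => //.
have /andP[h1 h2] : 0 <= ((col c)%:R + u) / N <= 1.
  by apply: subcell01; [exact: col_lt|move: u01 => /andP[? ?]; lra].
by rewrite /= in_itv /=; lra.
Qed.

Lemma line_leb_pattern (phi L : R) :
  thin (shadow P (sin (theta - phi) / sin theta) (sin phi / sin theta)) L ->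
  (line_leb (phi + pi / 2)
     (projection (phi + pi / 2) (mirrors_union pattern_mirrors)) <= L%:E)%E.
Proof.
move=> th; apply: thin_measure; move: th.
apply: (@thin_translate R _ _ (sin phi / sin theta)) => z /= [p pG ez].
have -> : z = dotp p (expi (phi + pi / 2)).
  have dotpZ (a : R) :
      dotp (a *: expi (phi + pi / 2)) (expi (phi + pi / 2)) = a.
    by rewrite dotpZl dotp_expi mulr1.
  by rewrite -(dotpZ z) -ez dotpZ.
have [c [u [u01 ->]]] := pattern_mirrors_pointP p pG.
(* A mirror is the diagonal of its cell, so both offsets are [u]. *)
exists c, u, u; split => //; rewrite dotp_place -/N; ring.
Qed.

End mirrors.
End geometry.

Arguments sin_lower_bound {R e}.
Arguments pattern_mirrors {R} theta P.
Arguments cell_mirror_nondegenerate {R theta} theta_pi P s.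
Arguments ae_transfer {R theta} theta_pi P.
Arguments line_leb_pattern {R theta} theta_pi P phi L.

Theorem theorem1p3 (R : realType) (theta eps : R)
    (htheta : 0 < theta < pi) (heps : 0 < eps) :
  exists G : seq (mirror R),
    [/\ forall s, s \in G -> s.1 <> s.2,
        {ae lebesgue_measure, forall r : R, r \in `[0, 1] ->
           (forall gam, light_ray G gam -> comes_from gam (1, 0) (0, r) ->
              reflects_once G gam) /\
           (exists2 vw, transfer G ((1, 0), (0, r)) vw &
              exit_directions theta vw)}
      & forall alpha : R,
          alpha - pi / 2 \in `[eps, theta - eps] \/
          alpha - pi / 2 \in `[theta + eps, pi - eps] ->
          (line_leb alpha (projection alpha (mirrors_union G)) < eps%:E)%E].
Proof.
have s0 := sin_gt0_pi htheta.
have [d d0 dsin] := sin_lower_bound heps.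
(* Both coefficients are of the form sin x / sin theta with |sin x| between d and 1. Half of [eps]
   leaves room for the strict inequality. *)
have [||| P thinP] :=
    @exists_thin_pattern R (sin theta)^-1 (d / sin theta) (eps / 2).
- by rewrite invr_gt0.
- by rewrite divr_gt0.
- by rewrite divr_gt0.
exists (pattern_mirrors theta P); split.
- exact: cell_mirror_nondegenerate.
- exact: ae_transfer.
move=> alpha; have -> : alpha = alpha - pi / 2 + pi / 2 by rewrite subrK.
move: (alpha - _) => phi; rewrite addrK !in_itv /= => phi_range.
apply: (@le_lt_trans _ _ (eps / 2)%:E); last by rewrite lte_fin; lra.
have slope_bound (x : R) : d <= `|sin x| ->
    d / sin theta <= `|sin x / sin theta| <= (sin theta)^-1.
  move=> dx; rewrite normrM normfV (gtr0_norm s0).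
  rewrite ler_pM2r ?invr_gt0 // dx ler_piMl ?invr_ge0 ?(ltW s0) //.
  exact: sin_max.
apply: line_leb_pattern => //; apply: thinP; apply: slope_bound.
  (* In the first range theta - phi lies in [eps, pi - eps], in the second phi - theta does. *)
  case: phi_range => range.
    by rewrite (le_trans _ (ler_norm _)) // dsin //; lra.
  rewrite -normrN -sinN opprB (le_trans _ (ler_norm _)) // dsin //; lra.
by rewrite (le_trans _ (ler_norm _)) // dsin //; case: phi_range; lra.
Qed.
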